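(* Let $A,B$ be commutative rings with unity, $f:A\to B$ a ring homomorphism, and $J$ an ideal of $B$ which is finitely generated as an $A$-module (via $f$). Then $A\bowtie^f J$ is universally catenary if and only if $A$ is universally catenary.
   Context: For a ring homomorphism $f:A\to B$ of commutative rings and an ideal $J$ of $B$, the amalgamation is the subring $A\bowtie^f J:=\{(a,f(a)+j)\mid a\in A,\ j\in J\}$ of $A\times B$. A locally finite dimensional commutative ring $R$ (every localization at a prime has finite Krull dimension) is catenary if for all primes $\mathfrak p\subseteq\mathfrak q$ every saturated chain of primes joining $\mathfrak p$ and $\mathfrak q$ has length equal to the height of $\mathfrak q/\mathfrak p$. $R$ is universally catenary if all the polynomial rings $R[X_1,\ldots,X_n]$ are catenary. *)

(* Defs.v *)
From HB Require Import structures.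
From mathcomp Require Import all_boot all_algebra ring_quotient generic_quotient.
From mathcomp Require Import boolp mpoly ring.

Set Implicit Arguments.
Unset Strict Implicit.
Unset Printing Implicit Defensive.

Import GRing.Theory.
Local Open Scope ring_scope.
Local Open Scope quotient_scope.

(* Ideals are boolean predicates, as in ring_quotient; under the classical
   axioms of boolp these are exactly the subsets of the ring. *)

(* The library's [idealr] only covers proper ideals; here J = B is allowed. *)
HB.mixin Record isMulAbsorbing (R : comPzRingType) (S : R -> bool) := {
  ideal_absorb : forall a, {in S, forall u, a * u \in S}
}.

#[short(type="ideal")]
HB.structure Definition Ideal (R : comPzRingType) :=
  {S of GRing.ZmodClosed R S & isMulAbsorbing R S}.

Section Amalgamation.
Variables (A B : comPzRingType) (f : {rmorphism A -> B}) (J : ideal B).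

(* (a, b) is of the form (a, f a + j) with j in J *)
Definition amalg_pred : pred (A * B) := fun x => x.2 - f x.1 \in J.

Lemma amalg_predE (x : A * B) : (x \in amalg_pred) = (x.2 - f x.1 \in J).
Proof. by []. Qed.

Lemma amalg_predP (x : A * B) :
  reflect (exists2 j, j \in J & x = (x.1, f x.1 + j)) (x \in amalg_pred).
Proof.
rewrite amalg_predE; case: x => a b /=; apply: (iffP idP) => [Jx|[j Jj [->]]].
  by exists (b - f a); rewrite // addrC subrK.
by rewrite addrAC subrr add0r.
Qed.

Lemma amalg_subring : subring_closed amalg_pred.
Proof.
split=> [|x y|x y]; rewrite !amalg_predE /=.
- by rewrite rmorph1 subrr rpred0.
- move=> Jx Jy; rewrite rmorphB opprB.
  have -> : x.2 - y.2 + (f y.1 - f x.1) = (x.2 - f x.1) - (y.2 - f y.1).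
    by rewrite opprB addrACA [RHS]addrACA [- y.2 + _]addrC [- f x.1 - _]addrC.
  exact: rpredB.
- move=> Jx Jy; rewrite rmorphM.
  have -> : x.2 * y.2 - f x.1 * f y.1
            = y.2 * (x.2 - f x.1) + f x.1 * (y.2 - f y.1).
    by rewrite !mulrBr addrA (mulrC y.2) (mulrC y.2) subrK.
  by apply: rpredD; apply: ideal_absorb.
Qed.

HB.instance Definition _ := GRing.isSubringClosed.Build (A * B)%type amalg_pred
  amalg_subring.

Record amalg := Amalg { amalg_val :> A * B; _ : amalg_val \in amalg_pred }.

HB.instance Definition _ := [isSub for amalg_val].
HB.instance Definition _ := [Choice of amalg by <:].
HB.instance Definition _ :=
  GRing.SubChoice_isSubComPzRing.Build (A * B)%type amalg_pred amalg amalg_subring.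

Definition fg_module_via : Prop :=
  exists (n : nat) (g : 'I_n -> B),
    (forall i, g i \in J) /\
    (forall x, x \in J -> exists c : 'I_n -> A, x = \sum_i f (c i) * g i).

End Amalgamation.

Module Localization.
Section Localization.
Variables (R : comNzRingType) (p : prime_idealr R).

Record frac := Frac { fracval :> R * R; _ : fracval.2 \notin p }.

#[export]
HB.instance Definition _ := [isSub for fracval].
#[export]
HB.instance Definition _ := [Choice of frac by <:].

Implicit Types x y z : frac.

Lemma denP x : x.2 \notin p. Proof. by case: x. Qed.

Lemma one_notin : 1 \notin p. Proof. by rewrite idealr1. Qed.

Lemma mul_notin (s t : R) : s \notin p -> t \notin p -> s * t \notin p.
Proof. by move=> ps pt; rewrite prime_idealrM negb_or ps pt. Qed.

Definition equivl x y : bool :=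
  `[< exists2 u : R, u \notin p & u * (x.1 * y.2 - y.1 * x.2) = 0 >].

Lemma equivl_refl : reflexive equivl.
Proof.
by move=> x; apply/asboolP; exists 1; rewrite ?one_notin // subrr mulr0.
Qed.

Lemma equivl_sym : ssrbool.symmetric equivl.
Proof.
have H x y : equivl x y -> equivl y x.
  move=> /asboolP[u pu e]; apply/asboolP; exists u => //.
  by rewrite -opprB mulrN e oppr0.
by move=> x y; apply/idP/idP; apply: H.
Qed.

Lemma equivl_trans : transitive equivl.
Proof.
move=> y x z /asboolP[u pu e] /asboolP[v pv h]; apply/asboolP.
exists (u * v * y.2); first by rewrite !mul_notin ?denP.
have -> : u * v * y.2 * (x.1 * z.2 - z.1 * x.2) =
  v * z.2 * (u * (x.1 * y.2 - y.1 * x.2)) +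
  u * x.2 * (v * (y.1 * z.2 - z.1 * y.2)) by ring.
by rewrite e h !mulr0 addr0.
Qed.

Canonical equivl_equiv := EquivRel equivl equivl_refl equivl_sym equivl_trans.

Definition type := {eq_quot equivl}.
#[export]
HB.instance Definition _ : EqQuotient _ equivl type := EqQuotient.on type.
#[export]
HB.instance Definition _ := Choice.on type.

Definition emb (a : R) : frac := @Frac (a, 1) one_notin.
Definition addl x y : frac :=
  @Frac (x.1 * y.2 + y.1 * x.2, x.2 * y.2) (mul_notin (denP x) (denP y)).
Definition oppl x : frac := @Frac (- x.1, x.2) (denP x).
Definition mull x y : frac :=
  @Frac (x.1 * y.1, x.2 * y.2) (mul_notin (denP x) (denP y)).

Lemma equivl_repr x : equivl x (repr (\pi_type x)).
Proof. by apply/eqmodP; rewrite reprK. Qed.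

Definition add := lift_op2 type addl.
Lemma pi_add : {morph \pi : x y / addl x y >-> add x y}.
Proof.
move=> x y; unlock add; apply/eqmodP => /=.
have /asboolP[u pu e] := equivl_repr x; have /asboolP[v pv h] := equivl_repr y.
move: (repr (\pi_type x)) (repr (\pi_type y)) e h => x' y' e h.
apply/asboolP; exists (u * v); rewrite ?mul_notin //=.
have -> : u * v * ((x.1 * y.2 + y.1 * x.2) * (x'.2 * y'.2)
                 - (x'.1 * y'.2 + y'.1 * x'.2) * (x.2 * y.2)) =
  v * y.2 * y'.2 * (u * (x.1 * x'.2 - x'.1 * x.2)) +
  u * x.2 * x'.2 * (v * (y.1 * y'.2 - y'.1 * y.2)) by ring.
by rewrite e h !mulr0 addr0.
Qed.
Canonical pi_add_morph := PiMorph2 pi_add.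

Definition opp := lift_op1 type oppl.
Lemma pi_opp : {morph \pi : x / oppl x >-> opp x}.
Proof.
move=> x; unlock opp; apply/eqmodP => /=.
have /asboolP[u pu e] := equivl_repr x.
apply/asboolP; exists u => //=.
by rewrite !mulNr -opprD mulrN e oppr0.
Qed.
Canonical pi_opp_morph := PiMorph1 pi_opp.

Definition mul := lift_op2 type mull.
Lemma pi_mul : {morph \pi : x y / mull x y >-> mul x y}.
Proof.
move=> x y; unlock mul; apply/eqmodP => /=.
have /asboolP[u pu e] := equivl_repr x; have /asboolP[v pv h] := equivl_repr y.
move: (repr (\pi_type x)) (repr (\pi_type y)) e h => x' y' e h.
apply/asboolP; exists (u * v); rewrite ?mul_notin //=.
have -> : u * v * (x.1 * y.1 * (x'.2 * y'.2) - x'.1 * y'.1 * (x.2 * y.2)) =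
  v * y.1 * y'.2 * (u * (x.1 * x'.2 - x'.1 * x.2)) +
  u * x'.1 * x.2 * (v * (y.1 * y'.2 - y'.1 * y.2)) by ring.
by rewrite e h !mulr0 addr0.
Qed.
Canonical pi_mul_morph := PiMorph2 pi_mul.

Definition of_base := lift_embed type emb.
Canonical of_base_morph := PiEmbed of_base.

Lemma eq_frac x y : x.1 * y.2 = y.1 * x.2 -> \pi_type x = \pi_type y.
Proof.
move=> e; apply/eqmodP/asboolP; exists 1; first exact: one_notin.
by rewrite e subrr mulr0.
Qed.

Lemma addA : associative add.
Proof.
elim/quotW=> x; elim/quotW=> y; elim/quotW=> z; rewrite !piE.
by apply: eq_frac => /=; ring.
Qed.

Lemma addC : commutative add.
Proof.
by elim/quotW=> x; elim/quotW=> y; rewrite !piE; apply: eq_frac => /=; ring.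
Qed.

Lemma add0l : left_id (of_base 0) add.
Proof. by elim/quotW=> x; rewrite !piE; apply: eq_frac => /=; ring. Qed.

Lemma addNl : left_inverse (of_base 0) opp add.
Proof. by elim/quotW=> x; rewrite !piE; apply: eq_frac => /=; ring. Qed.

#[export]
HB.instance Definition _ := GRing.isZmodule.Build type addA addC add0l addNl.

Lemma mulA : associative mul.
Proof.
elim/quotW=> x; elim/quotW=> y; elim/quotW=> z; rewrite !piE.
by apply: eq_frac => /=; ring.
Qed.

Lemma mulC : commutative mul.
Proof.
by elim/quotW=> x; elim/quotW=> y; rewrite !piE; apply: eq_frac => /=; ring.
Qed.

Lemma mul1l : left_id (of_base 1) mul.
Proof. by elim/quotW=> x; rewrite !piE; apply: eq_frac => /=; ring. Qed.

Lemma mulDl : left_distributive mul add.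
Proof.
elim/quotW=> x; elim/quotW=> y; elim/quotW=> z; rewrite !piE.
by apply: eq_frac => /=; ring.
Qed.

Lemma nonzero1 : of_base 1 != of_base 0.
Proof.
rewrite piE; apply/asboolP => -[u pu] /=.
by rewrite mulr1 mul0r subr0 mulr1 => u0; rewrite u0 rpred0 in pu.
Qed.

#[export]
HB.instance Definition _ :=
  GRing.Zmodule_isComNzRing.Build type mulA mulC mul1l mulDl nonzero1.

End Localization.

Module Exports.
HB.reexport.
Canonical equivl_equiv.
Canonical pi_add_morph.
Canonical pi_opp_morph.
Canonical pi_mul_morph.
Canonical of_base_morph.
End Exports.
End Localization.
Export Localization.Exports.

Notation localization := Localization.type.

Section Chains.
Variable R : comNzRingType.
Implicit Types (p q r : prime_idealr R) (c : nat -> prime_idealr R) (n : nat).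

Definition prime_lt p q : Prop := {subset p <= q} /\ ~ {subset q <= p}.

(* The chain c 0 < c 1 < ... < c n, of length n; the values of c beyond n are
   irrelevant. *)
Definition prime_chain c n : Prop :=
  forall i, (i < n)%N -> prime_lt (c i) (c i.+1).

Definition saturated_chain p q c n : Prop :=
  [/\ c 0%N =i p, c n =i q, prime_chain c n &
      forall i, (i < n)%N -> ~ exists r, prime_lt (c i) r /\ prime_lt r (c i.+1)].

Definition finite_krull_dim : Prop :=
  exists n, forall c m, prime_chain c m -> (m <= n)%N.

Definition has_height q n : Prop :=
  (exists2 c, prime_chain c n & c n =i q) /\
  (forall c m, prime_chain c m -> c m =i q -> (m <= n)%N).

End Chains.

Section QuotientPrime.
Variables (R : comNzRingType) (p q : prime_idealr R).
Hypothesis le_pq : {subset p <= q}.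

Definition quot_pred : pred {ideal_quot p} :=
  fun y => `[< exists2 x, x \in q & y = \pi_{ideal_quot p} x >].

Lemma quot_predE x : (\pi_{ideal_quot p} x \in quot_pred) = (x \in q).
Proof.
apply/asboolP/idP => [[z qz /eqP]|qx]; last by exists x.
rewrite -Quotient.idealrBE => /le_pq qxz.
by rewrite -(subrK z x) rpredD.
Qed.

Lemma quot_pred_ideal : idealr_closed quot_pred.
Proof.
split=> [||a y z].
- by rewrite -(rmorph0 (\pi_{ideal_quot p})) quot_predE rpred0.
- by rewrite -(rmorph1 (\pi_{ideal_quot p})) quot_predE idealr1.
- elim/quotW: a => a; elim/quotW: y => y; elim/quotW: z => z.
  rewrite -rmorphM -rmorphD !quot_predE => qy qz.
  by rewrite rpredD ?idealMr.
Qed.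

Lemma quot_pred_prime : prime_idealr_closed quot_pred.
Proof.
elim/quotW=> y; elim/quotW=> z.
by rewrite -rmorphM !quot_predE prime_idealrM.
Qed.

(* the prime ideal q/p of R/p *)
Definition quot_prime : prime_idealr {ideal_quot p} :=
  HB.pack quot_pred (isIdealr.Build {ideal_quot p} quot_pred quot_pred_ideal)
    (isPrimeIdealrClosed.Build {ideal_quot p} quot_pred quot_pred_prime).

End QuotientPrime.

Definition locally_finite_dim (R : comNzRingType) : Prop :=
  forall p : prime_idealr R, finite_krull_dim (localization p).

Definition catenary (R : comNzRingType) : Prop :=
  locally_finite_dim R /\
  forall (p q : prime_idealr R) (le_pq : {subset p <= q})
         (c : nat -> prime_idealr R) (n : nat),
    saturated_chain p q c n -> has_height (quot_prime le_pq) n.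

Definition nonzero_ring (R : comPzRingType) (nz : 1 != 0 :> R) :
  comNzRingType := HB.pack (R : Type) R (GRing.PzSemiRing_isNonZero.Build R nz).

(* {mpoly R[n]} requires 1 != 0 in R.  Polynomial rings over the zero ring are
   zero, hence have no primes and are vacuously catenary. *)
Definition universally_catenary (R : comPzRingType) : Prop :=
  forall (nz : 1 != 0 :> R) (n : nat), catenary {mpoly (nonzero_ring nz)[n]}.

(* Main.v *)
Require Import Defs.
From HB Require Import structures.
From mathcomp Require Import all_boot all_algebra.
From mathcomp Require Import ring_quotient generic_quotient boolp mpoly ring.

(* A ⋈ J is an algebra of finite type over A through a |-> (a, f a), generated
   by the (0, g_i) for generators g_i of the A-module J; conversely A is the
   quotient of A ⋈ J by 0 × J.  So it suffices that an algebra of finite type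
   over a universally catenary ring is universally catenary.  Polynomial rings
   over such an algebra are quotients of polynomial rings over the base, and
   catenarity passes to quotients: contraction of primes along a quotient map,
   as along a localization, is an embedding of posets with convex image, so it
   preserves saturated chains and the heights of quotients q/p. *)

Set Implicit Arguments.
Unset Strict Implicit.
Unset Printing Implicit Defensive.

Import GRing.Theory.
Import (coercions) Localization.
Local Open Scope ring_scope.
Local Open Scope quotient_scope.

Section PrimeChains.
Variable R : comNzRingType.
Implicit Types (p q : prime_idealr R) (c : nat -> prime_idealr R).

Lemma prime_idealr_ext p q : p =i q -> p = q.
Proof.
case: p q => P cP [Q cQ] eqPQ.
have {}eqPQ : P = Q by apply/funext => x; apply: (eqPQ x).
case: _ / eqPQ in cQ *; congr PrimeIdealr.Pack.
case: cP cQ => [[?] [?] [?] [?]] [[?] [?] [?] [?]].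
by congr PrimeIdealr.Class; congr (_ _); apply: Prop_irrelevance.
Qed.

Lemma prime_chain_sub c n i j :
  prime_chain c n -> (i <= j <= n)%N -> {subset c i <= c j}.
Proof.
move=> cP; elim: j => [|j IHj] /andP[le_ij le_jn].
  by move: le_ij; rewrite leqn0 => /eqP->.
move: le_ij; rewrite leq_eqVlt => /predU1P[->//|le_ij] x cx.
by apply: (cP j le_jn).1; apply: IHj; rewrite // -ltnS le_ij ltnW.
Qed.

Definition chain_over p q c n : Prop :=
  [/\ prime_chain c n, {subset p <= c 0%N} & c n = q].

Definition has_height_over p q n : Prop :=
  (exists c, chain_over p q c n) /\
  (forall c m, chain_over p q c m -> (m <= n)%N).

Lemma has_height_over_least p q n :
  (forall r : prime_idealr R, {subset p <= r}) ->
  has_height_over p q n <-> has_height q n.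
Proof.
move=> p_least; split=> -[[c]].
  move=> [cP _ cq] max; split; first by exists c; rewrite ?cq.
  by move=> d m dP /prime_idealr_ext dq; apply: (max d).
move=> cP /prime_idealr_ext cq max; split; first by exists c.
by move=> d m [dP _ dq]; apply: (max d); rewrite ?dq.
Qed.

End PrimeChains.

Section Comap.
Variables (R S : comNzRingType) (phi : {rmorphism R -> S}).

Section ComapPrime.
Variable q : prime_idealr S.

Definition comap_pred : pred R := fun x => phi x \in q.

Lemma comap_predE x : (x \in comap_pred) = (phi x \in q).
Proof. by []. Qed.

Lemma comap_pred_ideal : idealr_closed comap_pred.
Proof.
split=> [||a x y]; rewrite !comap_predE.
- by rewrite rmorph0 rpred0.
- by rewrite rmorph1 idealr1.
- by move=> qx qy; rewrite rmorphD rmorphM rpredD ?idealMr.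
Qed.

Lemma comap_pred_prime : prime_idealr_closed comap_pred.
Proof. by move=> x y; rewrite !comap_predE rmorphM prime_idealrM. Qed.

Definition comap : prime_idealr R :=
  HB.pack comap_pred (isIdealr.Build R comap_pred comap_pred_ideal)
    (isPrimeIdealrClosed.Build R comap_pred comap_pred_prime).

Lemma mem_comap x : (x \in comap) = (phi x \in q).
Proof. exact: comap_predE. Qed.

End ComapPrime.

Definition inverted (s : R) : Prop := exists t, phi s * t = 1.

Lemma inverted1 : inverted 1.
Proof. by exists 1; rewrite rmorph1 mulr1. Qed.

Lemma invertedM s s' : inverted s -> inverted s' -> inverted (s * s').
Proof.
move=> [t st] [t' st']; exists (t * t').
by rewrite rmorphM mulrACA st st' mulr1.
Qed.

Lemma inverted_notin_comap q s : inverted s -> s \notin comap q.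
Proof.
by move=> [t st]; apply/negP => /(idealMr t); rewrite mulrC st idealr1.
Qed.

(* Covers both quotient maps, where s = 1 will do, and localizations. *)
Definition surjective_up_to_units : Prop :=
  forall y, exists x s, inverted s /\ y * phi s = phi x.

Lemma surjective_up_to_units_surj :
  (forall y, exists x, phi x = y) -> surjective_up_to_units.
Proof.
move=> surj y; have [x xy] := surj y; exists x, 1.
by split; [apply: inverted1 | rewrite rmorph1 mulr1].
Qed.

Hypothesis phi_surj : surjective_up_to_units.

Lemma comap_subP (q q' : prime_idealr S) :
  {subset comap q <= comap q'} <-> {subset q <= q'}.
Proof.
split=> le_qq'; last by move=> x; rewrite !mem_comap; apply: le_qq'.
move=> y qy; have [x [s [us yx]]] := phi_surj y.
have : x \in comap q' by apply: le_qq'; rewrite mem_comap -yx mulrC idealMr.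
rewrite mem_comap -yx prime_idealrM => /orP[//|].
by rewrite -mem_comap (negbTE (inverted_notin_comap q' us)).
Qed.

Lemma comap_ltP q q' : prime_lt (comap q) (comap q') <-> prime_lt q q'.
Proof. by rewrite /prime_lt !comap_subP. Qed.

Lemma comap_inj : injective comap.
Proof.
have sub q q' : comap q = comap q' -> {subset q <= q'}.
  by move=> eq_qq'; apply/comap_subP; rewrite eq_qq'.
move=> q q' eq_qq'; apply/prime_idealr_ext => y.
by apply/idP/idP; apply: sub.
Qed.

Section ExtendPrime.
Variable q : prime_idealr R.
Hypothesis ker_q : forall x, phi x = 0 -> x \in q.
Hypothesis inverted_notin_q : forall s, inverted s -> s \notin q.

Definition extend_pred : pred S :=
  fun y => `[< exists x s, [/\ x \in q, inverted s & y * phi s = phi x] >].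

Lemma extend_predE y x s :
  inverted s -> y * phi s = phi x -> (y \in extend_pred) = (x \in q).
Proof.
move=> us yx; apply/asboolP/idP; last by exists x, s.
move=> [x' [s' [qx' us' yx']]].
have q_sub : x * s' - x' * s \in q.
  by apply: ker_q; rewrite rmorphB !rmorphM -yx -yx'; ring.
have : x * s' \in q.
  by rewrite -(subrK (x' * s) (x * s')) rpredD // mulrC idealMr.
by rewrite prime_idealrM (negbTE (inverted_notin_q us')) orbF.
Qed.

Lemma extend_pred_map x : (phi x \in extend_pred) = (x \in q).
Proof. by apply: (extend_predE inverted1); rewrite rmorph1 mulr1. Qed.

Lemma extend_pred_ideal : idealr_closed extend_pred.
Proof.
split=> [||a y z].
- by rewrite -(rmorph0 phi) extend_pred_map rpred0.
- by rewrite -(rmorph1 phi) extend_pred_map idealr1.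
have [xa [sa [ua ea]]] := phi_surj a.
have [xy [sy [uy ey]]] := phi_surj y; have [xz [sz [uz ez]]] := phi_surj z.
have e : (a * y + z) * phi (sa * sy * sz) = phi (sz * xa * xy + sa * sy * xz).
  by rewrite rmorphD !rmorphM -ea -ey -ez; ring.
rewrite (extend_predE uy ey) (extend_predE uz ez).
rewrite (extend_predE (invertedM (invertedM ua uy) uz) e) => qy qz.
by rewrite rpredD ?idealMr.
Qed.

Lemma extend_pred_prime : prime_idealr_closed extend_pred.
Proof.
move=> y z.
have [xy [sy [uy ey]]] := phi_surj y; have [xz [sz [uz ez]]] := phi_surj z.
have e : y * z * phi (sy * sz) = phi (xy * xz).
  by rewrite !rmorphM -ey -ez mulrACA.
rewrite (extend_predE uy ey) (extend_predE uz ez).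
by rewrite (extend_predE (invertedM uy uz) e) prime_idealrM.
Qed.

Definition extend_prime : prime_idealr S :=
  HB.pack extend_pred (isIdealr.Build S extend_pred extend_pred_ideal)
    (isPrimeIdealrClosed.Build S extend_pred extend_pred_prime).

Lemma comap_onto : exists q', comap q' = q.
Proof. by exists extend_prime; apply/prime_idealr_ext/extend_pred_map. Qed.

End ExtendPrime.

Lemma comap_convex (p q : prime_idealr S) (r : prime_idealr R) :
  {subset comap p <= r} -> {subset r <= comap q} -> exists r', comap r' = r.
Proof.
move=> le_pr le_rq; apply: comap_onto => [x x0|s us].
  by apply: le_pr; rewrite mem_comap x0 rpred0.
exact: contra (@le_rq s) (inverted_notin_comap q us).
Qed.

Lemma comap_chain c n :
  prime_chain c n -> prime_chain (fun i => comap (c i)) n.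
Proof. by move=> cP i /cP /comap_ltP. Qed.

Lemma comap_chain_lift (c : nat -> prime_idealr R) n :
  prime_chain c n -> (forall i, (i <= n)%N -> exists q, comap q = c i) ->
  exists2 d, prime_chain d n & forall i, (i <= n)%N -> comap (d i) = c i.
Proof.
move=> cP c_onto.
have /choice[d dP] i : exists q, comap q = c (minn i n).
  exact/c_onto/geq_minr.
have dE i : (i <= n)%N -> comap (d i) = c i.
  by move=> /minn_idPl le_in; rewrite dP le_in.
exists d => // i lt_in; apply/comap_ltP.
by rewrite !dE ?(ltnW lt_in) //; apply: cP.
Qed.

Lemma comap_saturated_chain p q c n : saturated_chain p q c n ->
  saturated_chain (comap p) (comap q) (fun i => comap (c i)) n.
Proof.
move=> [c0 cn cP c_sat]; split=> [x|x||i lt_in [r [ltr rlt]]].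
- by rewrite !mem_comap c0.
- by rewrite !mem_comap cn.
- exact: comap_chain.
have [r' r'E] := comap_convex ltr.1 rlt.1.
by apply: (c_sat i lt_in); exists r'; split; apply/comap_ltP; rewrite r'E.
Qed.

Lemma comap_chain_over p q c n : chain_over p q c n ->
  chain_over (comap p) (comap q) (fun i => comap (c i)) n.
Proof.
by move=> [cP le_pc <-]; split=> //; [apply: comap_chain | apply/comap_subP].
Qed.

Lemma comap_chain_over_lift p q c n : chain_over (comap p) (comap q) c n ->
  exists d, chain_over p q d n.
Proof.
move=> [cP le_pc cq].
have [i le_in|d dP dE] := comap_chain_lift cP.
  apply: (@comap_convex p q) => x cx; last first.
    by rewrite -cq; apply: (prime_chain_sub cP _ cx); rewrite le_in /=.
  by apply: (prime_chain_sub cP (i := 0)) (le_pc x cx).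
exists d; split=> //; first by apply/comap_subP; rewrite dE.
by apply: comap_inj; rewrite dE.
Qed.

Lemma has_height_over_comap p q n :
  has_height_over (comap p) (comap q) n <-> has_height_over p q n.
Proof.
split=> -[[c cP] max]; split.
- exact: comap_chain_over_lift cP.
- by move=> d m /comap_chain_over; apply: max.
- by exists (fun i => comap (c i)); apply: comap_chain_over.
- by move=> d m /comap_chain_over_lift[d']; apply: max.
Qed.

End Comap.

Section LocalizationPrimes.
Variables (R : comNzRingType) (p : prime_idealr R).
Local Notation Rp := (localization p).

Definition loc_map (a : R) : Rp := \pi_Rp (Localization.emb p a).

Lemma loc_map_is_zmod_morphism : zmod_morphism loc_map.
Proof.
by move=> x y; rewrite /loc_map !piE; apply: Localization.eq_frac => /=; ring.
Qed.

Lemma loc_map_is_monoid_morphism : monoid_morphism loc_map.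
Proof.
split=> [|x y]; rewrite /loc_map !piE //.
by apply: Localization.eq_frac => /=; ring.
Qed.

HB.instance Definition _ :=
  GRing.isZmodMorphism.Build R Rp loc_map loc_map_is_zmod_morphism.
HB.instance Definition _ :=
  GRing.isMonoidMorphism.Build R Rp loc_map loc_map_is_monoid_morphism.

Lemma loc_map_eq0 x : loc_map x = 0 -> exists2 u, u \notin p & u * x = 0.
Proof.
rewrite -(rmorph0 loc_map) => /eqmodP/asboolP[u pu /=].
by rewrite mulr1 mul0r subr0; exists u.
Qed.

Lemma loc_map_inverted s : inverted loc_map s <-> s \notin p.
Proof.
split=> [[]|ps]; last first.
  exists (\pi_Rp (@Localization.Frac _ p (1, s) ps)).
  rewrite -(rmorph1 loc_map) /loc_map !piE.
  by apply: Localization.eq_frac => /=; ring.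
elim/quotW=> z; rewrite -(rmorph1 loc_map) /loc_map piE.
move=> /eqmodP/asboolP[u pu /=]; rewrite mulr1 !mul1r mulrBr => /subr0_eq usz.
apply: contra (Localization.mul_notin pu (Localization.denP z)) => s_in_p.
by rewrite -usz mulrCA mulrC idealMr.
Qed.

Lemma loc_map_surjective_up_to_units : surjective_up_to_units loc_map.
Proof.
elim/quotW=> x; exists x.1, x.2; split.
  exact/loc_map_inverted/Localization.denP.
by rewrite /= /loc_map !piE; apply: Localization.eq_frac => /=; ring.
Qed.

Lemma comap_loc_map_sub (q : prime_idealr Rp) : {subset comap loc_map q <= p}.
Proof.
move=> x; apply: contraTT => /loc_map_inverted; exact: inverted_notin_comap.
Qed.

Lemma comap_loc_map_onto (q : prime_idealr R) :
  {subset q <= p} -> exists q', comap loc_map q' = q.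
Proof.
move=> le_qp; have notin_q s : s \notin p -> s \notin q by apply/contra/le_qp.
apply: (comap_onto loc_map_surjective_up_to_units) => [x|s].
  move=> /loc_map_eq0[u pu ux].
  by have := rpred0 q; rewrite -ux prime_idealrM (negbTE (notin_q u pu)).
by move=> /loc_map_inverted/notin_q.
Qed.

Lemma finite_krull_dim_locP :
  finite_krull_dim Rp <->
  exists n, forall (c : nat -> prime_idealr R) m,
    prime_chain c m -> {subset c m <= p} -> (m <= n)%N.
Proof.
have surj := loc_map_surjective_up_to_units.
split=> -[n max]; exists n => c m cP.
  move=> le_cp; have [i le_im|d /max//] := comap_chain_lift surj cP.
  apply: comap_loc_map_onto => x cx.
  by apply/le_cp/(prime_chain_sub cP _ cx); rewrite le_im /=.
exact: max (comap_chain surj cP) (@comap_loc_map_sub _).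
Qed.

End LocalizationPrimes.

Lemma has_height_quotP (R : comNzRingType) (p q : prime_idealr R)
    (le_pq : {subset p <= q}) n :
  has_height (quot_prime le_pq) n <-> has_height_over p q n.
Proof.
pose pi : {rmorphism R -> {ideal_quot p}} := \pi_{ideal_quot p}.
have surj : surjective_up_to_units pi.
  by apply: surjective_up_to_units_surj; elim/quotW=> x; exists x.
have comap_quot (r : prime_idealr R) (le_pr : {subset p <= r}) :
    comap pi (quot_prime le_pr) = r.
  by apply/prime_idealr_ext => x; rewrite mem_comap quot_predE.
pose zero := quot_prime (fun x (px : x \in p) => px).
have zero_least (r : prime_idealr {ideal_quot p}) : {subset zero <= r}.
  apply/(comap_subP surj); rewrite comap_quot => x px.
  rewrite mem_comap (_ : pi x = 0) ?rpred0 // -(rmorph0 pi).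
  by apply/eqP; rewrite -Quotient.idealrBE subr0.
rewrite -(has_height_over_least _ _ zero_least) -(has_height_over_comap surj).
by rewrite !comap_quot.
Qed.

Lemma catenary_surjective_up_to_units (R S : comNzRingType)
    (phi : {rmorphism R -> S}) :
  surjective_up_to_units phi -> catenary R -> catenary S.
Proof.
move=> surj [dimR catR]; split=> [q|p q le_pq c n c_sat].
  have /finite_krull_dim_locP[n max] := dimR (comap phi q).
  apply/finite_krull_dim_locP; exists n => c m cP le_cq.
  by apply: (max _ _ (comap_chain surj cP)); apply/(comap_subP surj).
have le_comap : {subset comap phi p <= comap phi q} by apply/comap_subP.
apply/has_height_quotP/(has_height_over_comap surj)/(has_height_quotP le_comap).
exact: catR (comap_saturated_chain surj c_sat).
Qed.

Section Adjoin.
Variables (A R : comPzRingType) (iota : {rmorphism A -> R}).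

Inductive adjoin (I : Type) (g : I -> R) : R -> Prop :=
| adjoin_base a : adjoin g (iota a)
| adjoin_gen i : adjoin g (g i)
| adjoinD x y : adjoin g x -> adjoin g y -> adjoin g (x + y)
| adjoinM x y : adjoin g x -> adjoin g y -> adjoin g (x * y).

Definition finite_type : Prop :=
  exists m (g : 'I_m -> R), forall x, adjoin g x.

Lemma adjoin_sum I (g : I -> R) T (r : seq T) (P : pred T) (F : T -> R) :
  (forall i, P i -> adjoin g (F i)) -> adjoin g (\sum_(i <- r | P i) F i).
Proof.
move=> gF; apply: big_ind => //; last exact: adjoinD.
by rewrite -(rmorph0 iota); apply: adjoin_base.
Qed.

Lemma adjoin_prod I (g : I -> R) T (r : seq T) (P : pred T) (F : T -> R) :
  (forall i, P i -> adjoin g (F i)) -> adjoin g (\prod_(i <- r | P i) F i).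
Proof.
move=> gF; apply: big_ind => //; last exact: adjoinM.
by rewrite -(rmorph1 iota); apply: adjoin_base.
Qed.

Lemma adjoinX I (g : I -> R) x n : adjoin g x -> adjoin g (x ^+ n).
Proof. by move=> gx; rewrite -[n]card_ord -prodr_const; apply: adjoin_prod. Qed.

Lemma finite_type_surj : (forall x, exists a, iota a = x) -> finite_type.
Proof.
move=> surj; exists 0%N, (fun=> 0) => x.
by have [a <-] := surj x; apply: adjoin_base.
Qed.

End Adjoin.

Lemma finite_type_mpolyC (A : comPzRingType) (R : comNzRingType)
    (iota : {rmorphism A -> R}) n :
  finite_type iota -> finite_type (@mpolyC n R \o iota).
Proof.
move=> [m [g g_gen]].
pose h (i : 'I_(m + n)) : {mpoly R[n]} :=
  match split i with inl j => (g j)%:MP | inr k => 'X_k end.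
pose iotaX : {rmorphism A -> {mpoly R[n]}} := @mpolyC n R \o iota.
have gen_const r : adjoin iotaX h r%:MP.
  elim: {r}(g_gen r) => [a|j|x y _ hx _ hy|x y _ hx _ hy].
  - exact: (adjoin_base iotaX).
  - have := adjoin_gen iotaX h (lshift n j).
    by rewrite /h (unsplitK (inl j)).
  - by rewrite mpolyCD; apply: adjoinD.
  - by rewrite mpolyCM; apply: adjoinM.
have gen_var k : adjoin iotaX h 'X_k.
  have := adjoin_gen iotaX h (rshift m k).
  by rewrite /h (unsplitK (inr k)).
exists (m + n)%N, h; elim/mpolyind => [|c u p _ _ hp]; first exact: gen_const 0.
apply: adjoinD hp; rewrite -mul_mpolyC; apply: adjoinM => //.
by rewrite mpolyXE_id; apply: adjoin_prod => i _; apply: adjoinX.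
Qed.

Lemma mmap_surj (A R : comNzRingType) (iota : {rmorphism A -> R}) m
    (g : 'I_m -> R) :
  (forall x, adjoin iota g x) -> forall x, exists p, mmap iota g p = x.
Proof.
move=> g_gen x.
elim: {x}(g_gen x) => [a|i|x y _ [p <-] _ [q <-]|x y _ [p <-] _ [q <-]].
- by exists a%:MP; rewrite mmapC.
- by exists 'X_i; rewrite mmapX mmap1U.
- by exists (p + q); rewrite rmorphD.
- by exists (p * q); rewrite rmorphM.
Qed.

(* nonzero_ring nzR has the operations of R but is not convertible to it as a
   comPzRingType, so finite_type has to be transported. *)
Lemma finite_type_nonzero_ring (A R : comPzRingType) (iota : {rmorphism A -> R})
    (nzA : 1 != 0 :> A) (nzR : 1 != 0 :> R) :
  finite_type iota ->
  @finite_type (nonzero_ring nzA) (nonzero_ring nzR) iota.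
Proof.
move=> [m [g g_gen]]; exists m, g => x.
elim: {x}(g_gen x) => [a|i|x y _ gx _ gy|x y _ gx _ gy].
- exact: adjoin_base.
- exact: adjoin_gen.
- exact: adjoinD gx gy.
- exact: adjoinM gx gy.
Qed.

Lemma universally_catenary_finite_type (A R : comPzRingType)
    (iota : {rmorphism A -> R}) :
  finite_type iota -> universally_catenary A -> universally_catenary R.
Proof.
move=> iota_ft catA nzR n.
have nzA : 1 != 0 :> A.
  by apply: contra nzR => /eqP e; rewrite -(rmorph1 iota) e rmorph0.
have iota_nz_ft := finite_type_nonzero_ring nzA nzR iota_ft.
have [m [g g_gen]] := finite_type_mpolyC n iota_nz_ft.
apply: catenary_surjective_up_to_units (catA nzA m).
exact/surjective_up_to_units_surj/(mmap_surj g_gen).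
Qed.

Section AmalgMorphisms.
Variables (A B : comPzRingType) (f : {rmorphism A -> B}) (J : ideal B).

Definition amalg_fst : {rmorphism amalg f J -> A} := fst \o val.

Lemma amalg_in_subproof a : (a, f a) \in amalg_pred f J.
Proof. by rewrite amalg_predE subrr rpred0. Qed.

Definition amalg_in (a : A) : amalg f J := Amalg (amalg_in_subproof a).

Lemma amalg_in_is_zmod_morphism : zmod_morphism amalg_in.
Proof. by move=> x y; apply: val_inj; rewrite rmorphB /= rmorphB. Qed.

Lemma amalg_in_is_monoid_morphism : monoid_morphism amalg_in.
Proof.
split=> [|x y]; apply: val_inj; first by rewrite /= !rmorph1.
by rewrite rmorphM /= rmorphM.
Qed.

HB.instance Definition _ :=
  GRing.isZmodMorphism.Build A (amalg f J) amalg_in amalg_in_is_zmod_morphism.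
HB.instance Definition _ :=
  GRing.isMonoidMorphism.Build A (amalg f J) amalg_in
    amalg_in_is_monoid_morphism.

Lemma amalg_fst_surj a : exists x, amalg_fst x = a.
Proof. by exists (amalg_in a). Qed.

Lemma amalg_in_finite_type : fg_module_via f J -> finite_type amalg_in.
Proof.
move=> [n [g [gJ g_gen]]].
have Jg i : (0, g i) \in amalg_pred f J.
  by rewrite amalg_predE /= rmorph0 subr0.
exists n, (fun i => Amalg (Jg i)) => x.
have [c cE] := g_gen _ (valP x : (val x).2 - f (val x).1 \in J).
have -> : x = amalg_in (val x).1 + \sum_i amalg_in (c i) * Amalg (Jg i).
  apply: val_inj; rewrite rmorphD rmorph_sum /=.
  rewrite (eq_bigr (fun i => (0, f (c i) * g i))); last first.
    by move=> i _; rewrite -[LHS]/(c i * 0, _) mulr0.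
  rewrite (surjective_pairing (\sum_i _)) !raddf_sum /= big1 // -cE /=.
  rewrite -[RHS]/(_ + 0, _ + _) addr0 addrC subrK; exact: surjective_pairing.
apply: adjoinD; first exact: adjoin_base.
apply: adjoin_sum => i _; apply: adjoinM; first exact: adjoin_base.
exact: (adjoin_gen _ (fun j => Amalg (Jg j))).
Qed.

End AmalgMorphisms.

Theorem corollary4p4 (A B : comPzRingType) (f : {rmorphism A -> B})
  (J : ideal B) (Jfg : fg_module_via f J) :
  universally_catenary (amalg f J) <-> universally_catenary A.
Proof.
split; apply: universally_catenary_finite_type.
  exact/finite_type_surj/(amalg_fst_surj f J).
exact: amalg_in_finite_type.
Qed.
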